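(* The logic $\mathrm{GUF}_1$ has the Craig interpolation property: for all vocabularies $\sigma$ and $\tau$ and all sentences $\varphi \in \mathrm{GUF}_1[\sigma]$ and $\psi \in \mathrm{GUF}_1[\tau]$, if $\varphi \models \psi$, then there exists a sentence $\chi \in \mathrm{GUF}_1[\sigma \cap \tau]$ such that $\varphi \models \chi$ and $\chi \models \psi$.
   Context: All vocabularies are relational: they contain no constants, no function symbols and no $0$-ary relation symbols. For a vocabulary $\sigma$, the guarded fragment $\mathrm{GF}[\sigma]$ is the smallest set of first-order formulas that contains all atomic formulas over $\sigma$ (including equalities between variables), is closed under $\neg$ and $\wedge$, and such that whenever $\psi \in \mathrm{GF}[\sigma]$ has all its free variables among the tuple $\overline{x}$, $\overline{y}$ is a tuple of variables with $\overline{y} \subseteq \overline{x}$, and $\alpha(\overline{x})$ is an atomic formula over $\sigma$, then $\exists \overline{y}(\alpha(\overline{x}) \wedge \psi(\overline{x})) \in \mathrm{GF}[\sigma]$. Subformulas are defined as usual, except that the subformulas of $\exists \overline{y}(\alpha(\overline{x}) \wedge \psi(\overline{x}))$ are this formula itself together with the subformulas of $(\alpha(\overline{x}) \wedge \psi(\overline{x}))$. A formula of $\mathrm{GF}$ is one-dimensional if each of its subformulas of the form $\exists \overline{y}(\alpha(\overline{x}) \wedge \psi(\overline{x}))$ has at most one free variable. For a set $X$ of variables, an $X$-atom over $\sigma$ is an atomic formula $R(x_{i_1},\dots,x_{i_k})$ with $R \in \sigma$ and $\{x_{i_1},\dots,x_{i_k}\} = X$. A relative $X$-atom over $\sigma$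 is a formula $\psi \in \mathrm{GF}[\sigma]$ such that (1) $\psi$ is a sentence, or (2) $\psi$ has one free variable and it belongs to $X$, or (3) $\psi$ is $x = y$ with $x,y \in X$, or (4) $\psi$ is an $X$-atom over $\sigma$, or (5) $\psi$ has the form $\exists \overline{z}(\alpha(\overline{x}) \wedge \psi'(\overline{x}))$ and its set of free variables is exactly $X$. A formula $\varphi \in \mathrm{GF}[\sigma]$ is uniform if every subformula $\psi$ of $\varphi$ is a Boolean combination of relative $X$-atoms, where $X$ is the set of free variables of $\psi$. $\mathrm{GUF}_1[\sigma]$ denotes the set of formulas of $\mathrm{GF}[\sigma]$ that are both uniform and one-dimensional. *)

(* Defs.v *)
From mathcomp Require Import all_boot.

Set Implicit Arguments.
Unset Strict Implicit.
Unset Printing Implicit Defensive.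

(* A universe of relation symbols, each carrying its own arity, from which all
   vocabularies are drawn. Positivity of the arity excludes 0-ary symbols. *)
Record signature := Signature {
  symbol :> Type;
  arity : symbol -> nat;
  arity_gt0 : forall R : symbol, 0 < arity R
}.

(* Not assumed finite, countable or decidable. *)
Definition vocabulary (S : signature) := symbol S -> Prop.

Definition vocI (S : signature) (sigma tau : vocabulary S) : vocabulary S :=
  fun R => sigma R /\ tau R.

(* First-order formulas over the variables x_0, x_1, ... A block of existential
   quantifiers is a single node, so that its inner suffixes are not subformulas. *)
Inductive formula (S : signature) :=
| Rel (R : S) (xs : (arity R).-tuple nat)
| Eq (x y : nat)
| Neg (phi : formula S)
| And (phi psi : formula S)
| Exists (ys : seq nat) (phi : formula S).

Arguments Eq {S} x y.

Fixpoint fv (S : signature) (phi : formula S) : seq nat :=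
  match phi with
  | Rel _ xs => tval xs
  | Eq x y => [:: x; y]
  | Neg psi => fv psi
  | And psi1 psi2 => fv psi1 ++ fv psi2
  | Exists ys psi => [seq x <- fv psi | x \notin ys]
  end.

Definition sentence (S : signature) (phi : formula S) : Prop :=
  fv phi = [::].

Fixpoint subformula (S : signature) (chi phi : formula S) : Prop :=
  chi = phi \/
  match phi with
  | Rel _ _ | Eq _ _ => False
  | Neg psi => subformula chi psi
  | And psi1 psi2 => subformula chi psi1 \/ subformula chi psi2
  | Exists _ psi => subformula chi psi
  end.

Record structure (S : signature) := Structure {
  dom :> Type;
  dom_inhabited : inhabited dom;
  interp : forall R : S, (arity R).-tuple dom -> Prop
}.

Fixpoint sat (S : signature) (M : structure S) (s : nat -> M)
    (phi : formula S) : Prop :=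
  match phi with
  | Rel R xs => interp (map_tuple s xs)
  | Eq x y => s x = s y
  | Neg psi => ~ sat s psi
  | And psi1 psi2 => sat s psi1 /\ sat s psi2
  | Exists ys psi =>
      exists2 s' : nat -> M,
        (forall x, x \notin ys -> s' x = s x) & sat s' psi
  end.

(* Structures interpret every symbol of S, but the truth of a formula depends
   only on the symbols that occur in it. *)
Definition entails (S : signature) (phi psi : formula S) : Prop :=
  forall (M : structure S) (s : nat -> M), sat s phi -> sat s psi.

Inductive atomic (S : signature) (sigma : vocabulary S) : formula S -> Prop :=
| atomic_Rel (R : S) (xs : (arity R).-tuple nat) :
    sigma R -> atomic sigma (Rel xs)
| atomic_Eq (x y : nat) : atomic sigma (Eq x y).

(* In the guarded quantifier, the tuple x-bar in alpha(x-bar) consists of the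
   variables of the guard alpha. *)
Inductive GF (S : signature) (sigma : vocabulary S) : formula S -> Prop :=
| GF_atomic alpha : atomic sigma alpha -> GF sigma alpha
| GF_Neg phi : GF sigma phi -> GF sigma (Neg phi)
| GF_And phi psi : GF sigma phi -> GF sigma psi -> GF sigma (And phi psi)
| GF_Exists ys alpha psi :
    ys != [::] -> atomic sigma alpha -> GF sigma psi ->
    {subset ys <= fv alpha} -> {subset fv psi <= fv alpha} ->
    GF sigma (Exists ys (And alpha psi)).

Definition one_dimensional (S : signature) (phi : formula S) : Prop :=
  forall ys alpha psi, subformula (Exists ys (And alpha psi)) phi ->
    size (undup (fv (Exists ys (And alpha psi)))) <= 1.

(* Finite sets X of variables are represented by sequences, compared with =i. *)
Definition X_atom (S : signature) (sigma : vocabulary S) (X : seq nat)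
    (psi : formula S) : Prop :=
  exists (R : S) (xs : (arity R).-tuple nat),
    [/\ sigma R, psi = Rel xs & tval xs =i X].

Definition relative_atom (S : signature) (sigma : vocabulary S) (X : seq nat)
    (psi : formula S) : Prop :=
  GF sigma psi /\
  [\/ sentence psi,
      exists2 x, fv psi =i [:: x] & x \in X,
      exists x y, [/\ psi = Eq x y, x \in X & y \in X] |
      X_atom sigma X psi \/
      (exists zs alpha psi', psi = Exists zs (And alpha psi') /\ fv psi =i X)].

Inductive bool_comb (S : signature) (P : formula S -> Prop) :
    formula S -> Prop :=
| bool_comb_base phi : P phi -> bool_comb P phi
| bool_comb_Neg phi : bool_comb P phi -> bool_comb P (Neg phi)
| bool_comb_And phi psi :
    bool_comb P phi -> bool_comb P psi -> bool_comb P (And phi psi).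

Definition uniform (S : signature) (sigma : vocabulary S)
    (phi : formula S) : Prop :=
  forall psi, subformula psi phi ->
    bool_comb (relative_atom sigma (fv psi)) psi.

Definition GUF1 (S : signature) (sigma : vocabulary S)
    (phi : formula S) : Prop :=
  [/\ GF sigma phi, uniform sigma phi & one_dimensional phi].

(* Main.v *)
Require Import Defs.
From mathcomp Require Import all_boot.
From HB Require Import structures.
From mathcomp Require Import boolp zify.

(* Suppose that M satisfies phi and N refutes psi, and that M and N agree on
   finitely many sentences over the shared symbols which guarantee that every
   element of each structure has a K-round bisimilar partner in the other. For
   k <= K, let P_k be the set of pairs (phi-type of a, psi-type of b) with a and b
   k-round bisimilar. The P_k decrease and there are finitely many type pairs, so
   P_k = P_{k+1} for some k < K if K is large: pairs of types in P_k can be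
   extended along guarded tuples within P_k for ever. Unravelling these
   extensions gives a tree of hyperedges whose nodes carry a pair in P_k; its
   elements have the phi-types and psi-types they are labelled with, so it
   satisfies phi and refutes psi. Hence, if phi entails psi, the disjunction of
   the theories, in these finitely many sentences, of the models of phi is an
   interpolant. One-dimensionality is what makes the tree suffice: two
   hyperedges need to share at most one element. *)

Set Implicit Arguments.
Unset Strict Implicit.
Unset Printing Implicit Defensive.

HB.instance Definition _ (S : signature) := gen_eqMixin (symbol S).
HB.instance Definition _ (S : signature) := gen_eqMixin (formula S).
HB.instance Definition _ (S : signature) (M : structure S) :=
  gen_eqMixin (dom M).

(** * Formulas *)

(** One-variable formulas are evaluated at an element under this assignment, so that the name of
    their variable is irrelevant. *)
Definition cst T (a : T) : nat -> T := fun=> a.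

Lemma map_tuple_eq_in (T : eqType) T' n (f g : T -> T') (xs : n.-tuple T) :
  {in xs, f =1 g} -> map_tuple f xs = map_tuple g xs.
Proof. by move=> fg; apply/val_inj/eq_in_map. Qed.

Lemma map_tuple_comp T T' T'' n (f : T' -> T'') (g : T -> T')
    (xs : n.-tuple T) :
  map_tuple f (map_tuple g xs) = map_tuple (f \o g) xs.
Proof. by apply/val_inj; rewrite /= map_comp. Qed.

Section Formulas.
Variable S : signature.
Implicit Types (M N : structure S) (phi psi theta : formula S).

Lemma sat_fv M theta (s s' : nat -> M) :
  {in fv theta, s =1 s'} -> sat s theta <-> sat s' theta.
Proof.
elim: theta s s' => [R xs|x y|psi IH|psi1 IH1 psi2 IH2|ys psi IH] s s' /= ss'.
- by rewrite (map_tuple_eq_in ss').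
- by rewrite !ss' ?inE ?eqxx ?orbT.
- by rewrite (IH s s').
- by rewrite (IH1 s s') 1?(IH2 s s') // => x xin; apply: ss';
    rewrite mem_cat xin ?orbT.
- suff imp (t t' : nat -> M) : {in [seq x <- fv psi | x \notin ys], t =1 t'} ->
     (exists2 r, (forall x, x \notin ys -> r x = t x) & sat r psi) ->
     (exists2 r, (forall x, x \notin ys -> r x = t' x) & sat r psi).
    by split; apply: imp => // x /ss'.
  move=> tt' [r rt rpsi].
  exists (fun x => if x \in ys then r x else t' x).
    by move=> x /negPf ->.
  rewrite -(IH r) // => x xpsi; case: ifPn => // xys.
  by rewrite rt // tt' // mem_filter xys.
Qed.

Lemma sat_fv_imp M theta (s s' : nat -> M) :
  {in fv theta, s =1 s'} -> sat s theta -> sat s' theta.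
Proof. by move=> /sat_fv[]. Qed.

Lemma subformula_refl phi : subformula phi phi.
Proof. by case: phi; left. Qed.

Lemma subformula_trans phi psi theta :
  subformula phi psi -> subformula psi theta -> subformula phi theta.
Proof.
move=> sub; elim: theta => [R xs|x y|th IH|th1 IH1 th2 IH2|ys th IH].
- by case=> // <-.
- by case=> // <-.
- by case=> [<-//|/IH]; right.
- by case=> [<-//|[/IH1|/IH2]]; right; [left|right].
- by case=> [<-//|/IH]; right.
Qed.

Lemma subformula_Neg phi psi : subformula (Neg phi) psi -> subformula phi psi.
Proof. by apply: subformula_trans; right; apply: subformula_refl. Qed.

Lemma subformula_Andl phi phi' psi :
  subformula (And phi phi') psi -> subformula phi psi.
Proof. by apply: subformula_trans; right; left; apply: subformula_refl. Qed.

Lemma subformula_Andr phi phi' psi :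
  subformula (And phi phi') psi -> subformula phi' psi.
Proof. by apply: subformula_trans; right; right; apply: subformula_refl. Qed.

Lemma subformula_Exists ys phi psi :
  subformula (Exists ys phi) psi -> subformula phi psi.
Proof. by apply: subformula_trans; right; apply: subformula_refl. Qed.

Fixpoint subs phi : seq (formula S) :=
  phi :: match phi with
  | Rel _ _ | Eq _ _ => [::]
  | Neg psi => subs psi
  | And psi1 psi2 => subs psi1 ++ subs psi2
  | Exists _ psi => subs psi
  end.

Lemma mem_subs theta phi : subformula theta phi -> theta \in subs phi.
Proof.
elim: phi => [R xs|x y|th IH|th1 IH1 th2 IH2|ys th IH] /=.
- by case=> // ->; rewrite inE.
- by case=> // ->; rewrite inE.
- by case=> [->|/IH]; rewrite inE ?eqxx // orbC => ->.
- by case=> [->|[/IH1|/IH2]]; rewrite inE ?eqxx // mem_cat => ->; rewrite !orbT.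
- by case=> [->|/IH]; rewrite inE ?eqxx // orbC => ->.
Qed.

Fixpoint syms phi : seq S :=
  match phi with
  | @Rel _ R _ => [:: R]
  | Eq _ _ => [::]
  | Neg psi => syms psi
  | And psi1 psi2 => syms psi1 ++ syms psi2
  | Exists _ psi => syms psi
  end.

Lemma mem_syms phi (R : S) :
  R \in syms phi <->
  exists xs : (arity R).-tuple nat, subformula (Rel xs) phi.
Proof.
split.
  elim: phi => [R' xs|x y|th IH|th1 IH1 th2 IH2|ys th IH] //=.
  - by rewrite inE => /eqP ->; exists xs; left.
  - by move=> /IH [xs ?]; exists xs; right.
  - by rewrite mem_cat => /orP[/IH1|/IH2] [xs ?]; exists xs; right;
      [left|right].
  - by move=> /IH [xs ?]; exists xs; right.
case=> xs; elim: phi => [R' xs'|x y|th IH|th1 IH1 th2 IH2|ys th IH] /=.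
- case=> // e; have -> : R = R' by case: e.
  by rewrite inE.
- by case.
- by case=> // /IH.
- by case=> // -[/IH1|/IH2]; rewrite mem_cat => ->; rewrite ?orbT.
- by case=> // /IH.
Qed.

Lemma size_undup_subset (s s' : seq nat) : {subset s <= s'} ->
  size (undup s) <= size (undup s').
Proof.
move=> ss'; apply: uniq_leq_size; first exact: undup_uniq.
by move=> x; rewrite !mem_undup; apply: ss'.
Qed.

Lemma size_undup_le1 (s : seq nat) : size (undup s) <= 1 ->
  s = [::] \/ exists x, s =i [:: x].
Proof.
case E: (undup s) => [|x [|//]] _; last first.
  by right; exists x => y; rewrite -mem_undup E.
by left; case: s E => // x s E; have := mem_undup (x :: s) x; rewrite E inE eqxx.
Qed.

Lemma GF_subformula (sigma : vocabulary S) theta phi :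
  GF sigma phi -> subformula theta phi -> GF sigma theta.
Proof.
move=> gphi; elim: gphi theta => {phi}.
- by move=> _ [R xs sR|x y] theta /= [->|//];
    apply: GF_atomic; constructor.
- by move=> phi g IH theta /= [->|/IH//]; apply: GF_Neg.
- by move=> phi psi g IH g' IH' theta /= [->|[/IH|/IH']//]; apply: GF_And.
- move=> ys alpha psi ys0 at_a gpsi IH ysa psia theta /= [->|].
    exact: GF_Exists.
  case=> [->|[|/IH//]]; first by apply: GF_And => //; apply: GF_atomic.
  by case: at_a => [R xs sR|x y] /= [->|//]; apply: GF_atomic; constructor.
Qed.

Lemma GF_syms (sigma : vocabulary S) phi (R : S) :
  GF sigma phi -> R \in syms phi -> sigma R.
Proof.
move=> g; elim: g => {phi}.
- by move=> _ [R' xs sR|x y] //=; rewrite inE => /eqP ->.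
- by [].
- by move=> phi psi _ IH _ IH' /=; rewrite mem_cat => /orP[].
- move=> ys alpha psi _ at_a _ IH _ _ /=; rewrite mem_cat => /orP[|//].
  by case: at_a => [R' xs sR|x y] //=; rewrite inE => /eqP ->.
Qed.

End Formulas.

(** * Bisimulations up to types *)

(** Index tuples of the X-atoms over an [n]-element set: repetitions are allowed, omissions are
    not. *)
Definition cover k n (js : k.-tuple nat) : Prop :=
  forall j, (j \in tval js) = (j < n).

Definition inj_below (T : Type) n (f : nat -> T) : Prop :=
  forall i j, i < n -> j < n -> f i = f j -> i = j.

Lemma index_cover (T : eqType) (a : T) A :
  {in a :: A, forall x, index x (a :: A) < (size A).+1}.
Proof. by move=> x xA; rewrite -index_mem in xA. Qed.

Lemma nth_uniq_inj (T : eqType) (a : T) A :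
  uniq (a :: A) -> inj_below (size A).+1 (nth a (a :: A)).
Proof. by move=> uA i j ltin ltjn /eqP; rewrite nth_uniq // => /eqP. Qed.

Section Truth.
Variables (S : signature) (sigma : vocabulary S) (phi : formula S).
Hypothesis phiP : GUF1 sigma phi.
Variables (U M : structure S) (lab : U -> M).

(* [edge n h a] relates the set of the [n] elements [h 0, ..., h n.-1] of U to
   the set of the [n] elements [a 0, ..., a n.-1] of M. *)
Variable edge : nat -> (nat -> U) -> (nat -> M) -> Prop.

Hypothesis edge_injU : forall n h a, edge n h a -> inj_below n h.
Hypothesis edge_injM : forall n h a, edge n h a -> inj_below n a.
Hypothesis edge_type : forall n h a, edge n h a -> forall i, i < n ->
  forall theta, subformula theta phi ->
  sat (cst (a i)) theta <-> sat (cst (lab (h i))) theta.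
Hypothesis edge_table : forall n h a, edge n h a -> forall R : S,
  R \in syms phi -> forall js : (arity R).-tuple nat, cover n js ->
  interp (map_tuple h js) <-> interp (map_tuple a js).
Hypothesis edge_single : forall u, edge 1 (cst u) (cst (lab u)).
Hypothesis edge_back : forall R : S, R \in syms phi ->
  forall us : (arity R).-tuple U, interp us ->
  exists n h a (js : (arity R).-tuple nat),
    [/\ edge n h a, cover n js & us = map_tuple h js].
(** Hyperedges are extended from a representative [a0] of the type of [lab u], since [lab u] itself
    may lack the required similarity. *)
Hypothesis edge_forth : forall u, exists2 a0,
  (forall theta, subformula theta phi ->
     sat (cst a0) theta <-> sat (cst (lab u)) theta) &
  forall n a, 0 < n -> inj_below n a -> a 0 = a0 ->
  exists2 h, edge n h a & h 0 = u.
Hypothesis edge_forth_any : forall n a, 0 < n -> inj_below n a ->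
  exists h, edge n h a.

Definition transfers theta := forall s : nat -> U,
  sat s theta <-> sat (lab \o s) theta.

(** Uniformity reduces [theta] to relative X-atoms, where [j] matches X with the whole hyperedge.
    Injectivity settles equalities and [edge_table] the X-atoms. A quantified formula with free
    variables X has at most one of them by one-dimensionality, so it falls, like sentences and
    one-variable formulas, under the assumption on [chi] and [edge_type]. *)
Lemma sat_edge theta n h a (j : nat -> nat) (s : nat -> U) (m : nat -> M) :
  subformula theta phi ->
  (forall chi, subformula chi theta -> size (undup (fv chi)) <= 1 ->
     transfers chi) ->
  edge n h a ->
  (forall x, x \in fv theta -> [/\ j x < n, s x = h (j x) & m x = a (j x)]) ->
  (forall i, i < n -> exists2 x, x \in fv theta & j x = i) ->
  sat s theta <-> sat m theta.
Proof.
move=> theta_phi IH e jP j_onto.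
have [_ uphi odphi] := phiP.
have one chi : subformula chi theta -> size (undup (fv chi)) <= 1 ->
    {subset fv chi <= fv theta} -> sat s chi <-> sat m chi.
  move=> chi_theta /[dup] /(IH _ chi_theta) -> /size_undup_le1[chi0|[x chix]] sub.
    by apply: sat_fv => y; rewrite chi0.
  have xchi : x \in fv chi by rewrite chix inE.
  have [ltjn sx mx] := jP x (sub _ xchi).
  rewrite (@sat_fv _ _ chi _ (cst (lab (s x)))); last first.
    by move=> y; rewrite chix inE => /eqP ->.
  rewrite sx -(edge_type e) //; last exact: subformula_trans theta_phi.
  by rewrite -mx; apply: sat_fv => y; rewrite chix inE => /eqP ->.
have := uphi _ theta_phi; move: (subformula_refl theta).
suff: forall chi, bool_comb (relative_atom sigma (fv theta)) chi ->
    subformula chi theta -> sat s chi <-> sat m chi.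
  by move=> H sub /H; apply.
move=> chi; elim=> {chi} [chi [_ chiP] chi_theta|chi _ IHc sub|
    chi1 chi2 _ IH1 _ IH2 sub]; last 2 first.
- by have := IHc (subformula_Neg sub); rewrite /=; tauto.
- have := IH1 (subformula_Andl sub); have := IH2 (subformula_Andr sub).
  by rewrite /=; tauto.
case: chiP => [chi0|[x chix xX]|[x [y [-> xX yX]]]|[[R [xs [_ chiE xsX]]]|
    [zs [al [th [chiE chiX]]]]]].
- by apply: one => //; rewrite chi0.
- apply: one => //; last by move=> y; rewrite chix inE => /eqP ->.
  rewrite -[1]/(size (undup [:: x])); apply: size_undup_subset => y.
  by rewrite chix.
- have [ltx sx mx] := jP _ xX; have [lty sy my] := jP _ yX.
  rewrite /= sx sy mx my; split.
    by move/(edge_injU e) ->.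
  by move/(edge_injM e) ->.
- rewrite chiE /= in chi_theta *.
  have -> : map_tuple s xs = map_tuple h (map_tuple j xs).
    rewrite map_tuple_comp; apply: map_tuple_eq_in => x.
    by rewrite xsX => /jP[].
  have -> : map_tuple m xs = map_tuple a (map_tuple j xs).
    rewrite map_tuple_comp; apply: map_tuple_eq_in => x.
    by rewrite xsX => /jP[].
  apply: (edge_table e).
    by apply/mem_syms; exists xs; apply: subformula_trans theta_phi.
  move=> i; apply/mapP/idP => [[x]|/j_onto[x xX <-]].
    by rewrite xsX => /jP[ltjn _ _] ->.
  by exists x; rewrite ?xsX.
- apply: one => //; last by move=> y; rewrite chiX.
  rewrite chiE; apply: odphi; rewrite -chiE.
  exact: subformula_trans theta_phi.
Qed.

(** A true relational guard lies on a hyperedge by [edge_back]; an equality guard is placed on a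
    singleton hyperedge. *)
Lemma guard_edge alpha (s : nat -> U) : subformula alpha phi ->
  atomic sigma alpha -> sat s alpha ->
  exists n h a j, [/\ edge n h a,
    forall x, x \in fv alpha -> j x < n /\ s x = h (j x) &
    forall i, i < n -> exists2 x, x \in fv alpha & j x = i].
Proof.
move=> alpha_phi at_a; case: at_a alpha_phi => [R xs _|x y] sub /=.
  move=> Us; have Rphi : R \in syms phi by apply/mem_syms; exists xs.
  have [n [h [a [js [e jsP xsE]]]]] := edge_back Rphi Us.
  (* The index is read at the first occurrence of [x] in the atom. *)
  pose j x := nth 0 js (index x xs).
  have jP x : x \in tval xs -> j x < n /\ s x = h (j x).
    move=> xxs; have ltx : index x xs < size xs by rewrite index_mem.
    split; first by rewrite -jsP mem_nth // size_tuple; rewrite size_tuple in ltx.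
    have /(congr1 (fun t => nth (h 0) (tval t) (index x xs))) := xsE.
    rewrite /= (nth_map 0) // nth_index // => ->.
    by rewrite (nth_map 0) // size_tuple; rewrite size_tuple in ltx.
  exists n, h, a, j; split=> // i ltin.
  have ijs : i \in tval js by rewrite jsP.
  have lti : index i js < size xs.
    by rewrite size_tuple; move: ijs; rewrite -index_mem size_tuple.
  have xin : nth 0 xs (index i js) \in tval xs by rewrite mem_nth.
  exists (nth 0 xs (index i js)) => //.
  have [ltj sE] := jP _ xin.
  apply: (edge_injU e) => //; rewrite -sE.
  have /(congr1 (fun t => nth (h 0) (tval t) (index i js))) := xsE.
  by rewrite /= (nth_map 0) // => ->; rewrite (nth_map 0) ?nth_index ?index_mem.
move=> sxy; exists 1, (cst (s x)), (cst (lab (s x))), (cst 0).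
split=> [//|z|[|//] _].
  by rewrite !inE => /orP[] /eqP ->; split.
by exists x; rewrite // inE eqxx.
Qed.

(** The distinct values of [m] on the free variables, with [m x] first, form an injective tuple to
    extend; positions in this list serve as [j] in [sat_edge]. The condition [Q] only records what
    is known of the anchor. *)
Lemma sat_lift theta (m : nat -> M) x (Q : U -> Prop) :
  subformula theta phi ->
  (forall chi, subformula chi theta -> size (undup (fv chi)) <= 1 ->
     transfers chi) ->
  x \in fv theta ->
  (forall n a, 0 < n -> inj_below n a -> a 0 = m x ->
   exists2 h, edge n h a & Q (h 0)) ->
  sat m theta -> exists2 s : nat -> U, sat s theta & Q (s x).
Proof.
move=> theta_phi IH xth forth mth.
set A := undup [seq a <- map m (fv theta) | a != m x].
have uA : uniq (m x :: A) by rewrite /= mem_undup mem_filter eqxx undup_uniq.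
have inA y : y \in fv theta -> m y \in m x :: A.
  move=> yth; rewrite inE mem_undup mem_filter.
  by case: eqP => //= _; apply: map_f.
have [h e Qh] := forth _ _ (ltn0Sn _) (nth_uniq_inj uA) erefl.
pose j y := index (m y) (m x :: A).
exists (h \o j); last by rewrite /= /j /= eqxx.
apply: (iffRL (sat_edge theta_phi IH e (j := j) _ _) mth).
  by move=> y yth; split=> //; [apply/index_cover/inA | rewrite nth_index ?inA].
move=> i lti.
have : nth (m x) (m x :: A) i \in m x :: A by rewrite mem_nth.
have jE y : m y = nth (m x) (m x :: A) i -> j y = i.
  by rewrite /j => ->; rewrite index_uniq.
rewrite inE mem_undup mem_filter => /orP[/eqP E|/andP[_ /mapP[y yth E]]].
  by exists x => //; apply: jE.
by exists y => //; apply: jE.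
Qed.

(** The induction carries the claim for all subformulas of [theta] at once: the body of a quantifier
    may have many free variables, and [sat_edge] needs the claim for its subformulas with at most
    one. For quantifiers, [guard_edge] moves truth to [M] and [sat_lift] moves it back. *)
Lemma truth theta : subformula theta phi -> size (undup (fv theta)) <= 1 ->
  transfers theta.
Proof.
move: theta; suff H theta : subformula theta phi ->
    forall chi, subformula chi theta -> size (undup (fv chi)) <= 1 ->
    transfers chi.
  by move=> theta sub; apply: H sub _ (subformula_refl _).
have [gphi _ odphi] := phiP.
elim: theta => [R xs|x y|psi IH|psi1 IH1 psi2 IH2|ys psi IH] sub chi.
- case=> // -> /size_undup_le1[/(congr1 size)|[x xsx] s].
    by rewrite size_tuple => E; have := arity_gt0 R; rewrite E.
  (* An atom with a single variable lives on the singleton hyperedge, all its entries being index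
     0. *)
  have E T (t : nat -> T) : map_tuple t xs =
      map_tuple (cst (t x)) (map_tuple (cst 0) xs).
    rewrite map_tuple_comp; apply: map_tuple_eq_in => y.
    by rewrite -[_ \in _]/(y \in fv (Rel xs)) xsx inE => /eqP ->.
  rewrite /= (E _ s) (E _ (lab \o s)); apply: (edge_table (edge_single _)).
    by apply/mem_syms; exists xs.
  move=> i; apply/mapP/idP => [[y _ ->] //|].
  case: i => // _; exists x => //.
  by rewrite -[_ \in _]/(x \in fv (Rel xs)) xsx inE.
- case=> // -> /size_undup_le1[//|[z zP] s].
  have /eqP -> : x == z by have := zP x; rewrite !inE eqxx => <-.
  have /eqP -> : y == z by have := zP y; rewrite !inE eqxx orbT => <-.
  by [].
- case=> [->|/(IH (subformula_Neg sub))//] sz s /=.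
  by have := IH (subformula_Neg sub) _ (subformula_refl _) sz s; tauto.
- case=> [->|[/(IH1 (subformula_Andl sub))|/(IH2 (subformula_Andr sub))]//].
  move=> sz s /=.
  have sz1 : size (undup (fv psi1)) <= 1.
    apply: leq_trans sz; apply: size_undup_subset => x.
    by rewrite mem_cat => ->.
  have sz2 : size (undup (fv psi2)) <= 1.
    apply: leq_trans sz; apply: size_undup_subset => x.
    by rewrite mem_cat orbC => ->.
  have := IH1 (subformula_Andl sub) _ (subformula_refl _) sz1 s.
  by have := IH2 (subformula_Andr sub) _ (subformula_refl _) sz2 s; tauto.
case=> [-> {chi}|/(IH (subformula_Exists sub))//].
have {}IH := IH (subformula_Exists sub).
move=> sz s.
have g := GF_subformula gphi sub.
case E: _ / g sub sz IH => [th at_a|||ys' alpha chi ys0 at_a _ ysa chia] //.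
  by case: at_a E.
case: E ys0 ysa => <- -> ys0 ysa sub sz IH.
set th := And alpha chi in sub sz IH *; set ex := Exists ys th in sub sz *.
have thX : fv th =i fv alpha.
  by move=> x; rewrite mem_cat; case: (boolP (x \in fv chi)) => [/chia ->|];
    rewrite ?orbF.
have th_phi := subformula_Exists sub.
split=> [[s' s's sth]|].
  have [n [h [a [j [e jP j_onto]]]]] :=
    guard_edge (subformula_Andl th_phi) at_a (proj1 sth).
  have Mth : sat (a \o j) th.
    apply: (iffLR (sat_edge th_phi IH e (j := j) _ _) sth).
      by move=> x; rewrite thX => /jP[].
    by move=> i /j_onto[x xa jx]; exists x; rewrite ?thX.
  have Mex : sat (a \o j) ex by exists (a \o j).
  case/size_undup_le1: sz => [ex0|[x exx]].
    by apply: sat_fv_imp Mex => y; rewrite ex0.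
  have : x \in fv ex by rewrite exx inE.
  rewrite mem_filter thX => /andP[xys /jP[ltj s'x]].
  have /(edge_type e ltj sub) : sat (cst (a (j x))) ex.
    by apply: sat_fv_imp Mex => y; rewrite exx inE => /eqP ->.
  by rewrite -s'x s's //; move=> H; apply: sat_fv_imp H => y;
    rewrite exx inE => /eqP ->.
move=> Mex.
(* The anchor [x] is the free variable of [ex], with [Q] pinning it to [s x]; if [ex] is a sentence,
   any guard variable serves and [Q] is trivial. *)
have [x [m [Q [xth mth forth Qs]]]] : exists x m (Q : U -> Prop),
    [/\ x \in fv th, sat m th,
        forall n a, 0 < n -> inj_below n a -> a 0 = m x ->
          exists2 h, edge n h a & Q (h 0) &
        forall t : nat -> U, Q (t x) -> {in fv ex, t =1 s}].
  case/size_undup_le1: (sz) => [ex0|[x exx]].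
    have [m _ mth] := Mex.
    have [x xa] : exists x, x \in fv alpha.
      by case: (ys) ysa ys0 => // y r /(_ y); rewrite inE eqxx => H _;
        exists y; apply: H.
    exists x, m, xpredT; split=> [|//|n a n0 ia _|t _ y]; rewrite ?thX ?ex0 //.
    by have [h e] := edge_forth_any n0 ia; exists h.
  have xex : x \in fv ex by rewrite exx inE.
  have [a0 a0P forth] := edge_forth (s x).
  have [m mx mth] : sat (cst a0) ex.
    by apply/a0P => //; apply: sat_fv_imp Mex => y; rewrite exx inE => /eqP ->.
  move: (xex); rewrite mem_filter => /andP[xys xth].
  exists x, m, (eq^~ (s x)); split=> // [n a n0 ia|t tx y].
    by rewrite mx //; apply: forth.
  by rewrite exx inE => /eqP ->.
have [t tth Qt] := sat_lift th_phi IH xth forth mth.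
exists (fun y => if y \in ys then t y else s y).
  by move=> y /negPf ->.
apply: sat_fv_imp tth => y yth; case: ifPn => // yys.
by rewrite (Qs t) // mem_filter yys.
Qed.

End Truth.

(** * Similarity and amalgamation *)

Section Similarity.
Variables (S : signature) (L : seq S).
Implicit Types M N : structure S.

Definition live M n (a : nat -> M) : Prop :=
  exists2 R : S, R \in L &
  exists2 js : (arity R).-tuple nat, cover n js & interp (map_tuple a js).

Definition agree M N n (a : nat -> M) (b : nat -> N) : Prop :=
  forall R : S, R \in L -> forall js : (arity R).-tuple nat, cover n js ->
  interp (map_tuple a js) <-> interp (map_tuple b js).

(** One direction of a round of a guarded bisimulation game that keeps a single element between
    rounds: only [a 0] is given, and the members are related one pair at a time. *)
Definition forth M N (r : M -> N -> Prop) (x : M) (y : N) : Prop :=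
  forall n (a : nat -> M), 0 < n -> inj_below n a -> a 0 = x -> live n a ->
  exists b : nat -> N, [/\ b 0 = y, inj_below n b, agree n a b &
    forall i, i < n -> r (a i) (b i)].

Fixpoint sim k M N (x : M) (y : N) : Prop :=
  match k with
  | 0 => agree 1 (cst x) (cst y)
  | k.+1 => [/\ sim k x y, forth (@sim k M N) x y &
                forth (fun y x => sim k x y) y x]
  end.

Lemma agree_sym M N n (a : nat -> M) (b : nat -> N) : agree n a b -> agree n b a.
Proof. by move=> ab R RL js c; rewrite ab. Qed.

Lemma sub_forth M N (r r' : M -> N -> Prop) x y :
  (forall x y, r x y -> r' x y) -> forth r x y -> forth r' x y.
Proof.
move=> rr' F n a n0 ia ax la; have [b [b0 ib ab rab]] := F n a n0 ia ax la.
by exists b; split=> // i /rab/rr'.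
Qed.

Lemma sim_sym k M N (x : M) (y : N) : sim k x y -> sim k y x.
Proof.
elim: k M N x y => [|k IH] M N x y /=; first exact: agree_sym.
case=> s f g; split; first exact: IH.
  by apply: sub_forth g => ? ?; apply: IH.
by apply: sub_forth f => ? ?; apply: IH.
Qed.

Lemma sim_le k l M N (x : M) (y : N) : k <= l -> sim l x y -> sim k x y.
Proof.
elim: l => [|l IH]; first by rewrite leqn0 => /eqP ->.
by rewrite leq_eqVlt ltnS => /orP[/eqP -> //|/IH H] [/H].
Qed.

End Similarity.

(** As long as the chain shrinks, each step loses an element, so [#|P k| + k] stays at most [#|T|];
    this is absurd at [k = #|T|.+1]. *)
Lemma chain_stabilises (T : finType) (P : nat -> {set T}) :
  (forall k, P k.+1 \subset P k) -> exists2 k, k <= #|T| & P k = P k.+1.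
Proof.
move=> dP; apply: contrapT => H.
have lt k : k <= #|T| -> P k.+1 \proper P k.
  move=> lek; rewrite properEneq dP andbT; apply/eqP => E.
  by apply: H; exists k.
have le k : k <= #|T|.+1 -> #|P k| + k <= #|T|.
  elim: k => [|k IH] lek; first by rewrite addn0 max_card.
  apply: leq_trans (IH (ltnW lek)); rewrite addnS -addSn leq_add2r.
  exact/proper_card/lt.
by have := leq_trans (leq_addl _ _) (le _ (leqnn _)); rewrite ltnn.
Qed.

Lemma bool_eq_neg (b c : bool) : c = b \/ c = ~~ b.
Proof. by case: b; case: c; [left|right|right|left]. Qed.

(** * The tree-shaped amalgam of two structures *)

Section Amalgam.
Variables (S : signature) (Ms : bool -> structure S) (f : bool -> formula S).
Variables (L : seq S) (k : nat).
Hypothesis mem_L : forall R : S, R \in L <-> (forall b, R \in syms (f b)).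

(** Indexing the two structures by [bool] makes one argument about a side [b] serve both. *)
Definition point := forall b, Ms b.

Definition mkpoint b : Ms b -> Ms (~~ b) -> point :=
  if b is true then fun x y c => if c is true then x else y
  else fun x y c => if c is true then y else x.

Lemma mkpoint_id b (x : Ms b) y : mkpoint x y b = x.
Proof. by case: b x y. Qed.

Lemma mkpoint_neg b (x : Ms b) y : mkpoint x y (~~ b) = y.
Proof. by case: b x y. Qed.

Definition psim l (p : point) := sim L l (p true) (p false).

Lemma psimE l b p : psim l p <-> sim L l (p b) (p (~~ b)).
Proof. by case: b => //; split=> /sim_sym. Qed.

Definition same_type b (x y : Ms b) :=
  forall theta, subformula theta (f b) ->
  sat (cst x) theta <-> sat (cst y) theta.

Lemma same_type_sym b (x y : Ms b) : same_type x y -> same_type y x.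
Proof. by move=> xy theta /xy ->. Qed.

(** Under a constant assignment the variables of an atom do not matter, so any occurrence of [R] in
    [f b] is a subformula deciding all atoms of [R] on a single element. *)
Lemma same_type_atom b (x y : Ms b) (R : S) : same_type x y ->
  R \in syms (f b) -> forall js : (arity R).-tuple nat,
  interp (map_tuple (cst x) js) <-> interp (map_tuple (cst y) js).
Proof.
move=> xy /mem_syms[xs /xy]; rewrite /= => H js.
have E (z : Ms b) : map_tuple (cst z) js = map_tuple (cst z) xs.
  by apply: eq_from_tnth => i; rewrite !tnth_map.
by rewrite (E x) (E y).
Qed.

(** The type pair of [p] lies in P_k; the components of [p] themselves need not be similar. *)
Definition compatible p :=
  exists2 q, psim k q & forall b, same_type (p b) (q b).

(** This is where P_k = P_{k+1} enters: one round can be spent without leaving P_k. *)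
Hypothesis stable : forall p, compatible p ->
  exists2 q, psim k.+1 q & forall b, same_type (p b) (q b).
Hypothesis total : forall b (x : Ms b), exists2 p, psim k.+1 p & p b = x.

Let cpoint := {p : point | compatible p}.

Definition at_side b (p : nat -> cpoint) i : Ms b := sval (p i) b.

Lemma psim_compatible p : psim k p -> compatible p.
Proof. by move=> sp; exists p. Qed.

Lemma psim_forth b (p : point) n (a : nat -> Ms b) : psim k.+1 p ->
  0 < n -> inj_below n a -> a 0 = p b -> live L n a ->
  exists q : nat -> point, [/\ forall c, q 0 c = p c,
    forall i, q i b = a i, inj_below n (fun i => q i (~~ b)),
    agree L n (fun i => q i true) (fun i => q i false) &
    forall i, i < n -> psim k (q i)].
Proof.
move=> /(psimE _ b)[_ F _] n0 ia a0 la.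
have [a' [a'0 ia' aa' sa']] := F n a n0 ia a0 la.
exists (fun i => mkpoint (a i) (a' i)); split.
- by move=> c; have [->|->] := bool_eq_neg b c; rewrite ?mkpoint_id ?mkpoint_neg.
- by move=> i; rewrite mkpoint_id.
- by move=> i j lti ltj; rewrite !mkpoint_neg; apply: ia'.
- move: {F} a ia a0 la a' a'0 ia' aa' sa'.
  by case: (b) => a _ _ _ a' _ _ //= H _; apply: agree_sym.
- by move=> i /sa' s; apply/(psimE _ b); rewrite mkpoint_id mkpoint_neg.
Qed.

Lemma cpoint_ex : exists _ : cpoint, True.
Proof.
have [x] := dom_inhabited (Ms true).
have [p [/psim_compatible cp _ _] _] := total x.
by exists (exist _ p cp).
Qed.

(* A node is the path leading to it: an item [((n, p), i)] is the step to the
   [i]-th member of a hyperedge with [n] members, labelled by [p 0, ..., p n.-1],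
   whose member 0 is the parent. The label of a child is its [p i], but the label
   of the parent only has the same types as [p 0]. *)
Definition node := seq ((nat * (nat -> cpoint)) * nat).

HB.instance Definition _ := gen_eqMixin node.

(** The root carries an arbitrary compatible point, which suffices for evaluating sentences. *)
Definition label (u : node) : cpoint :=
  if u is (e, i) :: _ then e.2 i else projT1 (cid cpoint_ex).

Definition child (u : node) (e : nat * (nat -> cpoint)) i : node :=
  if i is 0 then u else (e, i) :: u.

Lemma child_inj u e i j : child u e i = child u e j -> i = j.
Proof.
case: i j => [|i] [|j] //=.
- by move/(congr1 size) => /= /n_Sn.
- by move/(congr1 size) => /= /esym/n_Sn.
- by case=> ->.
Qed.

(** A tuple covering a hyperedge determines it: the parent is the shortest entry, and every other
    entry records the hyperedge in its first item. A singleton hyperedge contains only its parent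
    and leaves no record, hence the exception. *)
Lemma child_cover m (js js' : m.-tuple nat) u e u' e' : 0 < m ->
  cover e.1 js -> cover e'.1 js' ->
  map_tuple (child u e) js = map_tuple (child u' e') js' ->
  [/\ u = u', js = js' & e = e' \/ e.1 = 1 /\ e'.1 = 1].
Proof.
move=> m0 c c' E.
have mem v : (v \in map (child u e) js) = (v \in map (child u' e') js').
  by rewrite -[map (child u e) js]/(val (map_tuple (child u e) js)) E.
have pos n (ks : m.-tuple nat) : cover n ks -> 0 < n.
  move=> ck; apply: leq_ltn_trans (leq0n (tnth ks (Ordinal m0))) _.
  by rewrite -ck mem_tnth.
have in0 (v : node) d n (ks : m.-tuple nat) : cover n ks ->
    v \in map (child v d) ks.
  move=> ck; apply/mapP; exists 0 => //.
  by rewrite ck; apply: pos ck.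
have step (v v' : node) d ks : v \in map (child v' d) ks ->
    v = v' \/ size v = (size v').+1.
  by case/mapP => [[|i]] _ ->; [left|right].
(* Otherwise each of the two parents would be a child of the other, hence longer by one. *)
have uu' : u = u'.
  have /step[//|s1] : u \in map (child u' e') js' by rewrite -mem (in0 _ _ _ _ c).
  have /step[->//|s2] : u' \in map (child u e) js by rewrite mem (in0 _ _ _ _ c').
  by move: s1; rewrite s2 => /eqP; rewrite -addn2 -{1}[size u]addn0 eqn_add2l.
subst u'.
have one d d' (ks ks' : m.-tuple nat) : cover d.1 ks ->
    {subset map (child u d) ks <= map (child u d') ks'} -> d = d' \/ d.1 <= 1.
  move=> ck sub; case: (ltnP 1 d.1) => [lt1|]; last by right.
  have /sub/mapP[[|i] _ //=] : child u d 1 \in map (child u d) ks.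
  - by apply: map_f; rewrite ck.
  - by move/(congr1 size) => /= /esym/n_Sn.
  - by case; left.
have ee' : e = e' \/ e.1 = 1 /\ e'.1 = 1.
  have [|->|le1] := one e e' js js' c; first by move=> v; rewrite mem.
    by left.
  have [|->|le1'] := one e' e js' js c'; first by move=> v; rewrite mem.
    by left.
  by right; split; apply/eqP; rewrite eqn_leq ?le1 ?le1' (pos _ _ c, pos _ _ c').
split=> //; apply: eq_from_tnth => i.
have := congr1 (fun t => tnth t i) E; rewrite !tnth_map.
case: ee' => [->|[e1 e1']]; first by move/child_inj.
have := mem_tnth i js; have := mem_tnth i js'.
by rewrite c c' e1 e1'; case: (tnth _ _) => //; case: (tnth _ _).
Qed.

Definition link (u : node) (p : nat -> cpoint) :=
  forall b, same_type (at_side b p 0) (sval (label u) b).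

(* When the [b]-components form no shared hyperedge, the components on the
   other side are unconstrained, and the hyperedge is void on that side. *)
Definition good b n (p : nat -> cpoint) :=
  inj_below n (at_side b p) /\
  (live L n (at_side b p) ->
   inj_below n (at_side (~~ b) p) /\
   agree L n (at_side true p) (at_side false p)).

Definition tabled b (R : S) (us : (arity R).-tuple node) : Prop :=
  exists u n p (js : (arity R).-tuple nat),
    [/\ link u p, good b n p, cover n js,
        us = map_tuple (child u (n, p)) js &
        interp (map_tuple (at_side b p) js)].

(** A symbol is read from each side whose sentence contains it; for a shared symbol the two readings
    coincide by [tabled_flip]. *)
Definition amalgam : structure S :=
  @Structure S node (inhabits [::])
    (fun R us => exists2 b, R \in syms (f b) & tabled b us).

(** An atom of a symbol in [L] makes its own hyperedge live, so [good] yields agreement of the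
    sides, and with it goodness on the other side. *)
Lemma tabled_flip b c (R : S) (us : (arity R).-tuple node) : R \in L ->
  tabled b us -> tabled c us.
Proof.
move=> RL [u [n [p [js [lu [ib gb] c_js usE Rus]]]]].
have [->|->] := bool_eq_neg b c.
  by exists u, n, p, js.
have [|inb ag] := gb; first by exists R => //; exists js.
exists u, n, p, js; split=> //; last first.
  have := ag R RL js c_js.
  by case: (b) Rus => /= Rus H; apply/H.
by split=> // _; rewrite negbK.
Qed.

(** Agreement holds at a similar point of the same types; it passes to [z] because a symbol of [L]
    occurs in both sentences. *)
Lemma compatible_atom (z : cpoint) :
  agree L 1 (cst (sval z true)) (cst (sval z false)).
Proof.
case: z => p [q sq pq] /= R RL js c.
have /(_ R RL js c) ag := sim_le (leq0n k) sq.
have H b := same_type_atom (pq b) (proj1 (mem_L R) RL b) js.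
by rewrite H ag -(H false).
Qed.

Definition edge b n (h : nat -> node) (a : nat -> Ms b) :=
  exists u p, [/\ link u p, good b n p,
    forall i, i < n -> h i = child u (n, p) i &
    forall i, i < n -> a i = at_side b p i].

Lemma map_cover T n m (g h : nat -> T) (js : m.-tuple nat) : cover n js ->
  (forall i, i < n -> g i = h i) -> map_tuple g js = map_tuple h js.
Proof. by move=> c gh; apply: map_tuple_eq_in => i ijs; apply/gh; rewrite -c. Qed.

Lemma edge_exists b (u : node) n (q : nat -> point) : 0 < n ->
  (forall i, i < n -> psim k (q i)) ->
  (forall c, same_type (q 0 c) (sval (label u) c)) ->
  inj_below n (fun i => q i b) ->
  (live L n (fun i => q i b) -> inj_below n (fun i => q i (~~ b)) /\
    agree L n (fun i => q i true) (fun i => q i false)) ->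
  exists2 h, edge n h (fun i => q i b) & h 0 = u.
Proof.
move=> n0 sq uq ib gb.
(* The label of [u] is a mere default: every [q i] with [i < n] is compatible. *)
pose p i : cpoint := if pselect (compatible (q i)) is left H then exist _ _ H
  else label u.
have pE i : i < n -> sval (p i) = q i.
  by move=> /sq/psim_compatible H; rewrite /p; case: pselect.
have sE c i : i < n -> at_side c p i = q i c by move=> /pE E; rewrite /at_side E.
have ag c d : agree L n (fun i => q i c) (fun i => q i d) ->
    agree L n (at_side c p) (at_side d p).
  move=> H R RL js c_js.
  by rewrite (map_cover c_js (sE c)) (map_cover c_js (sE d)); apply: H.
exists (child u (n, p)) => //; exists u, p; split=> //.
- by move=> c; rewrite sE.
- split=> [i j lti ltj|[R RL [js c_js]]]; first by rewrite !sE //; apply: ib.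
  rewrite (map_cover c_js (sE b)) => Rus.
  have [|inb /ag abab] := gb; first by exists R => //; exists js.
  by split=> // i j lti ltj; rewrite !sE //; apply: inb.
- by move=> i lti; rewrite sE.
Qed.

(** A live tuple is extended by spending one round of similarity at [q]. For any other tuple [good]
    asks nothing of the opposite side, so [total] supplies partners member by member. *)
Lemma edge_exists_at b (u : node) (q : point) n (a : nat -> Ms b) :
  psim k.+1 q -> (forall c, same_type (q c) (sval (label u) c)) ->
  0 < n -> inj_below n a -> a 0 = q b -> exists2 h, edge n h a & h 0 = u.
Proof.
move=> sq uq n0 ia a0.
suff [r [rP [r0 ra rg]]] : exists r : nat -> point,
    (forall i, i < n -> psim k (r i)) /\
    [/\ forall c, r 0 c = q c, forall i, r i b = a i &
      live L n a -> inj_below n (fun i => r i (~~ b)) /\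
        agree L n (fun i => r i true) (fun i => r i false)].
  have aE : (fun i => r i b) = a by apply/funext.
  rewrite -aE; apply: edge_exists; rewrite ?aE //.
  by move=> c; rewrite r0.
have [la|nla] := pselect (live L n a).
  by have [r [r0 ra ir ag sr]] := psim_forth sq n0 ia a0 la; exists r.
exists (fun i => if i is 0 then q else projT1 (cid2 (total (a i)))).
split=> [[|i] _|]; first by case: sq.
  by case: cid2 => /= ? [].
by split=> // -[|i] //; case: cid2.
Qed.

(** An instance of [truth], with nodes projected to the [b]-component of their label. *)
Lemma amalgam_truth b sigma theta : GUF1 sigma (f b) ->
  subformula theta (f b) -> size (undup (fv theta)) <= 1 ->
  forall s : nat -> amalgam,
  sat s theta <-> sat (fun x => sval (label (s x)) b) theta.
Proof.
move=> fP sub sz; apply: (@truth S sigma (f b) fP amalgam (Ms b)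
  (fun u => sval (label u) b) (@edge b)) => //.
- move=> n h a [u [p [_ _ hE _]]] i j lti ltj.
  by rewrite !hE // => /child_inj.
- move=> n h a [u [p [_ [ip _] _ aE]]] i j lti ltj.
  by rewrite !aE //; apply: ip.
- move=> n h a [u [p [lu _ hE aE]]] i lti th thb.
  by rewrite hE // aE //; case: i lti => [|i] // _; apply: lu.
- move=> n h a [u [p [lu gp hE aE]]] R Rb js c_js.
  rewrite (map_cover c_js hE) (map_cover c_js aE).
  split=> [[c Rc tc]|Ra]; last by exists b => //; exists u, n, p, js.
  (* If the atom comes from the opposite side, [R] occurs in both sentences and the atom can be
     flipped. *)
  have {c Rc tc} [u' [n' [p' [js' [lu' _ c_js' E Rus]]]]] :
      tabled b (map_tuple (child u (n, p)) js).
    have [<-//|cb] := eqVneq c b.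
    apply: (@tabled_flip c) => //; apply/mem_L => d.
    by case: (c) (b) (d) cb Rc Rb => [] [] [].
  have [|e1 e2 e3] := child_cover (e := (n, p)) (e' := (n', p')) _ c_js c_js' E.
    exact: arity_gt0.
  (* Either the hyperedges coincide, or both consist of [u] alone. In the latter case their points
     may differ, but both are linked to the label of [u], whose types decide [R]. *)
  subst u' js'; case: e3 => [[_ ->] //|/= [n1 n1']].
  subst n n'; move: Rus.
  have aE1 (r : nat -> cpoint) i : i < 1 -> at_side b r i = cst (at_side b r 0) i.
    by case: i.
  rewrite !(map_cover c_js (aE1 _)).
  have lu2 := same_type_sym (lu b).
  by rewrite (same_type_atom (lu' b) Rb) (same_type_atom lu2 Rb).
- move=> u; exists u, (cst (label u)); split=> [c // | |[|//]|[|//]] //.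
  split=> [[|i] [|j] // _ _ _|_]; split=> [[|i] [|j] //|].
  exact: compatible_atom.
- move=> R Rb us [c Rc tc].
  have {c Rc tc} [u [n [p [js [lu gp c_js E Rus]]]]] : tabled b us.
    have [<-//|cb] := eqVneq c b.
    apply: (@tabled_flip c) => //; apply/mem_L => d.
    by case: (c) (b) (d) cb Rc Rb => [] [] [].
  by exists n, (child u (n, p)), (at_side b p), js; split=> //; exists u, p.
- move=> u; have [q sq uq] := stable (svalP (label u)).
  exists (q b) => [th thb|n a n0 ia a0].
    exact: same_type_sym (uq b) th thb.
  by apply: edge_exists_at n0 ia a0 => // c; apply/same_type_sym/uq.
move=> n a n0 ia; have [q sq qa] := total (a 0).
have cq : compatible q by apply: psim_compatible; case: sq.
(* Nodes are arbitrary lists, so any compatible point labels some node, reachable from the root or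
   not. *)
pose u : node := [:: ((0, cst (exist _ q cq)), 0)].
by have [//|h e _] := @edge_exists_at b u q n a sq _ n0 ia (esym qa); exists h.
Qed.

End Amalgam.

(** * Characteristic formulas *)

Section Closure.
Variables (S : signature) (sigma : vocabulary S).
Implicit Types (p q t d : formula S) (X : seq nat).

Let bc X := bool_comb (relative_atom sigma X).

Lemma bool_comb_eq_mem X X' p : X =i X' -> bc X p -> bc X' p.
Proof.
move=> XX'; elim=> {p} [p [g P]|p _|p q _ bp _]; last 2 first.
- exact: bool_comb_Neg.
- exact: bool_comb_And.
apply: bool_comb_base; split=> //.
case: P => [p0|[x px xX]|[x [y [E xX yX]]]|[[R [xs [sR E xsX]]]|
    [zs [al [th [E pX]]]]]].
- by constructor 1.
- by constructor 2; exists x; rewrite -?XX'.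
- by constructor 3; exists x, y; rewrite -!XX'.
- by constructor 4; left; exists R, xs; split=> // y; rewrite xsX.
- by constructor 4; right; exists zs, al, th; split=> // y; rewrite pX.
Qed.

Lemma GUF1_self p : GUF1 sigma p -> bc (fv p) p.
Proof. by case=> _ /(_ p (subformula_refl p)). Qed.

Lemma bool_comb_sentence X p : GUF1 sigma p -> sentence p -> bc X p.
Proof. by case=> g _ _ p0; apply: bool_comb_base; split=> //; constructor 1. Qed.

Lemma bool_comb_var X x p : GUF1 sigma p -> fv p =i [:: x] -> x \in X -> bc X p.
Proof.
by case=> g _ _ px xX; apply: bool_comb_base; split=> //; constructor 2; exists x.
Qed.

Lemma bool_comb_Eq X x y : x \in X -> y \in X -> bc X (Eq x y).
Proof.
move=> xX yX; apply: bool_comb_base; split.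
  by apply: GF_atomic; constructor.
by constructor 3; exists x, y.
Qed.

Lemma bool_comb_Rel X (R : S) (xs : (arity R).-tuple nat) : sigma R ->
  tval xs =i X -> bc X (Rel xs).
Proof.
move=> sR xsX; apply: bool_comb_base; split.
  by apply: GF_atomic; constructor.
by constructor 4; left; exists R, xs.
Qed.

Lemma GUF1_Eq x y : GUF1 sigma (Eq x y).
Proof.
split=> [|th [-> |//]|ys al th []//].
  by apply: GF_atomic; constructor.
by apply: bool_comb_Eq; rewrite !inE eqxx ?orbT.
Qed.

Lemma GUF1_Rel (R : S) (xs : (arity R).-tuple nat) : sigma R ->
  GUF1 sigma (Rel xs).
Proof.
move=> sR; split=> [|th [-> |//]|ys al th []//].
  by apply: GF_atomic; constructor.
exact: bool_comb_Rel.
Qed.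

Lemma GUF1_Neg p : GUF1 sigma p -> GUF1 sigma (Neg p).
Proof.
move=> pP; have [g u o] := pP; split=> [|th [->|/u//]|ys al th [//|/o//]].
  exact: GF_Neg.
exact: bool_comb_Neg (GUF1_self pP).
Qed.

Lemma GUF1_And p q : GUF1 sigma p -> GUF1 sigma q ->
  bc (fv (And p q)) p -> bc (fv (And p q)) q -> GUF1 sigma (And p q).
Proof.
move=> [gp up op] [gq uq oq] bp bq.
split=> [|th [->|[/up|/uq]//]|ys al th [//|[/op|/oq]//]].
  exact: GF_And.
exact: bool_comb_And.
Qed.

(** Having at most one free variable gives one-dimensionality and makes the formula itself a
    relative atom, hence uniform. *)
Lemma GUF1_Exists ys alpha p : ys != [::] -> atomic sigma alpha ->
  GUF1 sigma (And alpha p) -> GUF1 sigma p -> {subset ys <= fv alpha} ->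
  {subset fv p <= fv alpha} ->
  fv (Exists ys (And alpha p)) = [::] \/
    (exists x, fv (Exists ys (And alpha p)) =i [:: x]) ->
  GUF1 sigma (Exists ys (And alpha p)).
Proof.
move=> ys0 at_a [_ u o] [gp _ _] ysa pa ex1.
have gex : GF sigma (Exists ys (And alpha p)) by apply: GF_Exists.
split=> // [th [->|/u//]|zs al th [[-> -> ->]|/o//]].
  apply: bool_comb_base; split=> //.
  case: ex1 => [ex0|[x exx]]; first by constructor 1.
  by constructor 2; exists x; rewrite // exx inE.
case: ex1 => [->//|[x exx]].
by rewrite -[1]/(size (undup [:: x])); apply: size_undup_subset => y; rewrite exx.
Qed.

(* Seeding with [top] rather than ending in a closed formula gives all partial
   conjunctions the same free variables, as uniformity requires. *)
Fixpoint sign_conjs (top : formula S) (D : seq (formula S)) : seq (formula S) :=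
  if D is d :: D' then
    [seq And d t | t <- sign_conjs top D'] ++
    [seq And (Neg d) t | t <- sign_conjs top D']
  else [:: top].

Lemma sign_conjs_ex (M : structure S) (s : nat -> M) top D : sat s top ->
  exists2 t, t \in sign_conjs top D & sat s t.
Proof.
move=> stop; elim: D => [|d D [t tD st]] /=; first by exists top; rewrite ?inE.
have [sd|nsd] := pselect (sat s d).
  by exists (And d t) => //; rewrite mem_cat map_f.
by exists (And (Neg d) t) => //; rewrite mem_cat orbC map_f.
Qed.

Lemma sign_conjs_agree (M N : structure S) (s : nat -> M) (s' : nat -> N) top D t :
  t \in sign_conjs top D -> sat s t -> sat s' t ->
  forall d, d \in D -> sat s d <-> sat s' d.
Proof.
elim: D t => // d D IH t /=; rewrite mem_cat.
have split_mem e : (sat s d <-> sat s' d) ->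
    (forall e, e \in D -> sat s e <-> sat s' e) ->
    e \in d :: D -> sat s e <-> sat s' e.
  by move=> dd DD; rewrite inE => /orP[/eqP ->|/DD].
case/orP=> /mapP[t' tD ->] /= [sd st] [sd' st'] e; apply: split_mem => //.
  exact: IH tD st st'.
exact: IH tD st st'.
Qed.

Lemma sign_conjs_GUF1 X top D : GUF1 sigma top -> fv top =i X ->
  (forall d, d \in D -> [/\ GUF1 sigma d, bc X d & {subset fv d <= X}]) ->
  forall t, t \in sign_conjs top D -> GUF1 sigma t /\ fv t =i X.
Proof.
move=> gtop topX; elim: D => [|d D IH] DP t /=.
  by rewrite inE => /eqP ->.
have [gd bd dX] := DP d (mem_head _ _).
have {}IH := IH (fun e eD => DP e (mem_behead (s := d :: D) eD)).
have step e t' : GUF1 sigma e -> bc X e -> {subset fv e <= X} ->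
    t' \in sign_conjs top D -> GUF1 sigma (And e t') /\ fv (And e t') =i X.
  move=> ge be eX /IH[gt' t'X].
  have E : fv (And e t') =i X.
    move=> x; rewrite /= mem_cat t'X.
    by case: (boolP (x \in fv e)) => [/eX|].
  split=> //; apply: GUF1_And => //.
    by apply: bool_comb_eq_mem be => x; rewrite E.
  by apply: bool_comb_eq_mem (GUF1_self gt') => x; rewrite E t'X.
rewrite mem_cat => /orP[] /mapP[t' t'D ->]; apply: step => //.
  exact: GUF1_Neg.
exact: bool_comb_Neg.
Qed.

End Closure.

(** * Formulas determining similarity up to a number of rounds *)

Section Characteristic.
Variables (S : signature) (sigma : vocabulary S) (L : seq S).
Hypothesis L_sigma : forall R, R \in L -> sigma R.

Definition covers n (R : S) : seq ((arity R).-tuple nat) :=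
  [seq js <- [seq map_tuple val is_ | is_ : (arity R).-tuple 'I_n] |
    `[< cover n js >]].

Lemma mem_covers n (R : S) (js : (arity R).-tuple nat) :
  js \in covers n R <-> cover n js.
Proof.
rewrite mem_filter; split=> [/andP[/asboolP//]|c].
rewrite asboolT //=; case: n c => [|n] c.
  have := mem_tnth (Ordinal (arity_gt0 R)) js.
  by rewrite c.
apply/mapP; exists (map_tuple (@inord n) js); first by rewrite mem_enum.
rewrite map_tuple_comp; apply: eq_from_tnth => i; rewrite tnth_map /= inordK //.
by rewrite -c mem_tnth.
Qed.

(** Member [i] of a hyperedge is named by the variable [x + i], so the anchor is [x]. *)
Definition shifted (R : S) x (js : (arity R).-tuple nat) : formula S :=
  Rel (map_tuple (addn x) js).

Definition diagram n (F : nat -> seq (formula S)) x : seq (formula S) :=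
  [seq Eq (x + i) (x + j) | i <- iota 0 n, j <- iota 0 n] ++
  flatten [seq [seq shifted x js | js <- covers n R] | R <- L] ++
  flatten [seq F (x + i) | i <- iota 0 n].

(** The sizes start at 2, since a singleton hyperedge would need an empty quantifier block. They run
    to one above the arity, where no cover exists. *)
Definition witness_formulas (F : nat -> seq (formula S)) x : seq (formula S) :=
  flatten [seq flatten [seq flatten [seq
    [seq Exists (iota x.+1 n.-1) (And (shifted x js) t)
      | t <- sign_conjs (shifted x js) (diagram n F x)]
    | js <- covers n R] | n <- iota 2 (arity R)] | R <- L].

Fixpoint char_formulas k x : seq (formula S) :=
  match k with
  | 0 => [seq shifted x (nseq_tuple (arity R) 0) | R <- L]
  | k.+1 => char_formulas k x ++ witness_formulas (char_formulas k) x
  end.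

Lemma mem_witness_formulas F x theta : theta \in witness_formulas F x <->
  exists (R : S) n (js : (arity R).-tuple nat) t,
  [/\ R \in L, 1 < n < (arity R).+2, cover n js,
      t \in sign_conjs (shifted x js) (diagram n F x) &
      theta = Exists (iota x.+1 n.-1) (And (shifted x js) t)].
Proof.
split.
  case/flatten_mapP=> R RL /flatten_mapP[n]; rewrite mem_iota => nP.
  by case/flatten_mapP=> js /mem_covers c /mapP[t tP ->]; exists R, n, js, t.
case=> R [n [js [t [RL nP /mem_covers c tP ->]]]].
apply/flatten_mapP; exists R => //; apply/flatten_mapP; exists n.
  by rewrite mem_iota.
by apply/flatten_mapP; exists js => //; apply: map_f.
Qed.

Lemma mem_shifted n (R : S) x (js : (arity R).-tuple nat) y : cover n js ->
  (y \in fv (shifted x js)) = (y \in iota x n).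
Proof.
move=> c; rewrite mem_iota; apply/mapP/idP => [[j]|/andP[lexy lty]].
  by rewrite c => ltj ->; rewrite leq_addr ltn_add2l.
by exists (y - x); rewrite ?subnKC // c ltn_subLR.
Qed.

Lemma mem_diagram n F x d : d \in diagram n F x ->
  [\/ exists i j, [/\ i < n, j < n & d = Eq (x + i) (x + j)],
      exists (R : S) (js : (arity R).-tuple nat),
        [/\ R \in L, cover n js & d = shifted x js] |
      exists2 i, i < n & d \in F (x + i)].
Proof.
rewrite !mem_cat => /or3P[/allpairsP[[i j] /=]|/flatten_mapP[R RL]|/flatten_mapP[i]].
- by rewrite !mem_iota => -[lti ltj ->]; constructor 1; exists i, j.
- by move/mapP=> [js /mem_covers c ->]; constructor 2; exists R, js.
- by rewrite mem_iota => lti dF; constructor 3; exists i.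
Qed.

Lemma char_formulas_GUF1 k x theta : theta \in char_formulas k x ->
  GUF1 sigma theta /\ fv theta =i [:: x].
Proof.
elim: k x theta => [|k IH] x theta /=.
  case/mapP=> R RL ->; split; first exact/GUF1_Rel/L_sigma.
  move=> y; rewrite (@mem_shifted 1) // => j.
  by rewrite mem_nseq arity_gt0; case: j.
rewrite mem_cat => /orP[/IH//|].
case/mem_witness_formulas=> R [n [js [t [RL /andP[n1 _] c tP ->]]]].
have gt0 := GUF1_Rel (map_tuple (addn x) js) (L_sigma RL).
have [|gt tX] := sign_conjs_GUF1 gt0 (fun y => mem_shifted x y c) _ tP.
  move=> d /mem_diagram[[i [j [lti ltj ->]]]|[R' [js' [R'L c' ->]]]|[i lti /IH[gd dX]]].
  - split; first exact: GUF1_Eq.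
      by apply: bool_comb_Eq; rewrite mem_iota leq_addr ltn_add2l.
    by move=> y; rewrite !inE => /orP[] /eqP ->; rewrite mem_iota leq_addr ltn_add2l.
  - split; first exact/GUF1_Rel/L_sigma.
      by apply: bool_comb_Rel => [|y]; [exact: L_sigma | exact: mem_shifted].
    by move=> y; rewrite (mem_shifted x _ c').
  - split=> //.
      by apply: bool_comb_var gd dX _; rewrite mem_iota leq_addr ltn_add2l.
    by move=> y; rewrite dX inE => /eqP ->; rewrite mem_iota leq_addr ltn_add2l.
have exX : fv (Exists (iota x.+1 n.-1) (And (shifted x js) t)) =i [:: x].
  move=> y; rewrite mem_filter mem_cat tX (mem_shifted x _ c) orbb !mem_iota inE.
  by case: n n1 {c js t tP gt tX gt0} => // n _ /=; rewrite addSn addnS; lia.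
split=> //; apply: GUF1_Exists.
- by case: n n1 {c js t tP gt tX gt0 exX} => [|[|n]].
- by constructor; apply: L_sigma.
- apply: GUF1_And => //.
    apply: bool_comb_Rel => [|y]; first exact: L_sigma.
    by rewrite mem_cat tX -(mem_shifted x y c) orbb.
  apply: bool_comb_eq_mem (GUF1_self gt) => y.
  by rewrite mem_cat tX -(mem_shifted x y c) orbb.
- exact: gt.
- move=> y; rewrite (mem_shifted x y c) !mem_iota.
  by case: n n1 {c js t tP gt tX gt0 exX} => // n _ /=; lia.
- by move=> y; rewrite tX (mem_shifted x y c).
- by right; exists x.
Qed.

(** The sign conjunction true at the given tuple yields a witness formula true at [a0], hence at
    [b0]. The witnesses found there satisfy the same conjunction: its equalities give injectivity,
    its atoms agreement, and its formulas of level [k] similarity. *)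
Lemma char_formulas_forth k x (M N : structure S) (a0 : M) (b0 : N) :
  (forall y a b, (forall theta, theta \in char_formulas k y ->
     sat (cst a) theta <-> sat (cst b) theta) -> sim L k (a : M) (b : N)) ->
  sim L k a0 b0 ->
  (forall theta, theta \in witness_formulas (char_formulas k) x ->
     sat (cst a0) theta -> sat (cst b0) theta) ->
  forth L (@sim S L k M N) a0 b0.
Proof.
move=> IH simk wit n a n0 ia ax [R RL [js c Rjs]].
have sim0 := sim_le (leq0n k) simk.
case: (ltngtP n 1) => [||n1]; first by case: n n0 {ia c}.
  (* The default [a0] makes [m] agree with [cst a0] off the quantified block. *)
  move=> n1; pose m y := if x <= y < x + n then a (y - x) else a0.
  have mE i : i < n -> m (x + i) = a i.
    by move=> lti; rewrite /m leq_addr ltn_add2l lti addKn.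
  have shE (T : Type) (s : nat -> T) (e : nat -> T) (R' : S)
      (js' : (arity R').-tuple nat) : cover n js' ->
      (forall i, i < n -> s (x + i) = e i) ->
      map_tuple s (map_tuple (addn x) js') = map_tuple e js'.
    move=> c' H; rewrite map_tuple_comp; apply: map_tuple_eq_in => i.
    by rewrite -[_ \in _]/(i \in tval js') c' => /H.
  have mR : sat m (shifted x js) by rewrite /= (shE _ _ a).
  have [t tP mt] := sign_conjs_ex (diagram n (char_formulas k) x) mR.
  have ltn : n < (arity R).+2.
    rewrite ltnS; apply: leqW; rewrite -(size_tuple js) -(size_iota 0 n).
    by apply: uniq_leq_size (iota_uniq _ _) _ => i; rewrite mem_iota c.
  have [||s' s'P [/= s'R s't]] := wit (Exists (iota x.+1 n.-1) (And (shifted x js) t)).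
  - by apply/mem_witness_formulas; exists R, n, js, t; rewrite n1.
  - exists m; last by split.
    move=> y; rewrite mem_iota /m /cst => yP.
    case: ifP => // yP'; have -> : y = x by move: yP yP' n1; lia.
    by rewrite subnn.
  have agr := sign_conjs_agree tP mt s't.
  have inD d : (exists i j, [/\ i < n, j < n & d = Eq (x + i) (x + j)]) \/
      (exists (R : S) (js : (arity R).-tuple nat),
        [/\ R \in L, cover n js & d = shifted x js]) \/
      (exists2 i, i < n & d \in char_formulas k (x + i)) ->
      sat m d <-> sat s' d.
    move=> dP; apply: agr; rewrite !mem_cat; case: dP => [|[]].
    - case=> i [j [lti ltj ->]]; apply/orP; left.
      by apply/allpairsP; exists (i, j); rewrite !mem_iota.
    - case=> R' [js' [R'L /mem_covers c' ->]]; apply/or3P; constructor 2.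
      by apply/flatten_mapP; exists R' => //; apply: map_f.
    - case=> i lti dF; apply/or3P; constructor 3.
      by apply/flatten_mapP; exists i; rewrite ?mem_iota.
  exists (fun i => s' (x + i)); split.
  - by rewrite addn0 s'P // mem_iota ltnn.
  - move=> i j lti ltj E; apply: ia => //; rewrite -!mE //.
    by apply/(inD (Eq (x + i) (x + j))) => //; left; exists i, j.
  - move=> R' R'L js' c'; have := inD (shifted x js').
    rewrite /= (shE _ m a) // (shE _ s' (fun i => s' (x + i))) //.
    by apply; right; left; exists R', js'.
  - move=> i lti; apply: (IH (x + i)) => th thF.
    have [_ thX] := char_formulas_GUF1 thF.
    have loc (Q : structure S) (s : nat -> Q) : sat s th <-> sat (cst (s (x + i))) th.
      by apply: sat_fv => y; rewrite thX inE => /eqP ->.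
    by rewrite -mE // -!loc; apply: inD; right; right; exists i.
(* A singleton hyperedge is matched by [b0] itself, using similarity for 0 rounds. *)
subst n; exists (cst b0); split=> //.
- by case=> [|i] [|j].
- move=> R' R'L js' c'; rewrite -(sim0 R' R'L js' c') (map_cover (h := cst a0) c') //.
  by case.
- by case=> // _; rewrite ax.
Qed.

(** The induction generalises over [x] because members are described at the variables [x + i]. The
    backward direction is the forward one with the structures exchanged. *)
Lemma char_formulas_sim k x (M N : structure S) (a : M) (b : N) :
  (forall theta, theta \in char_formulas k x ->
     sat (cst a) theta <-> sat (cst b) theta) -> sim L k a b.
Proof.
elim: k x M N a b => [|k IH] x M N a b ab.
  move=> R RL js _; have /ab : shifted x (nseq_tuple (arity R) 0) \in char_formulas 0 x.
    by apply/mapP; exists R.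
  have E (Q : structure S) (q : Q) xs : map_tuple (cst q) xs =
      map_tuple (cst q) js by apply: eq_from_tnth => i; rewrite !tnth_map.
  by rewrite /= (E M) (E N).
have simk : sim L k a b.
  by apply: (IH x) => th thF; apply: ab; rewrite mem_cat thF.
have wit th : th \in witness_formulas (char_formulas k) x ->
    sat (cst a) th <-> sat (cst b) th.
  by move=> thW; apply: ab; rewrite mem_cat thW orbT.
split=> //.
  apply: (char_formulas_forth (x := x)) => //.
    by move=> y a' b'; apply: IH.
  by move=> th /wit ->.
apply: (@sub_forth _ _ _ _ (@sim S L k N M)) => [? ?|]; first exact: sim_sym.
apply: (char_formulas_forth (x := x)).
- by move=> y a' b'; apply: IH.
- exact: sim_sym.
- by move=> th /wit ->.
Qed.

(** Each sentence asserts that some element realises a given sign pattern; the guard [Eq 0 0] lets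
    the quantifier range over all elements. *)
Definition type_sentences k : seq (formula S) :=
  [seq Exists [:: 0] (And (Eq 0 0) t)
    | t <- sign_conjs (Eq 0 0) (char_formulas k 0)].

Lemma type_sentences_GUF1 k theta : theta \in type_sentences k ->
  GUF1 sigma theta /\ sentence theta.
Proof.
case/mapP=> t tP ->.
have Eq0 : fv (@Eq S 0 0) =i [:: 0] by move=> x; rewrite !inE orbb.
have [|gt tX] := sign_conjs_GUF1 (GUF1_Eq sigma 0 0) Eq0 _ tP.
  move=> d /char_formulas_GUF1[gd dX]; split=> //.
    by apply: bool_comb_var gd dX _; rewrite inE.
  by move=> x; rewrite dX.
have ex0 : fv (Exists [:: 0] (And (Eq 0 0) t)) = [::].
  apply/eqP; rewrite -[_ == _]negbK -has_filter; apply/hasPn => x.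
  by rewrite mem_cat tX Eq0 orbb negbK.
split=> //; apply: GUF1_Exists => //.
- by constructor.
- apply: GUF1_And => //; first exact: GUF1_Eq.
    by apply: bool_comb_Eq; rewrite !inE.
  by apply: bool_comb_eq_mem (GUF1_self gt) => x; rewrite mem_cat tX Eq0 orbb.
- by move=> x; rewrite Eq0.
- by move=> x; rewrite tX Eq0.
- by left.
Qed.

Lemma type_sentences_total k (M N : structure S) (s : nat -> M) (s' : nat -> N) :
  (forall theta, theta \in type_sentences k -> sat s theta -> sat s' theta) ->
  forall a : M, exists b : N, sim L k a b.
Proof.
move=> ss' a.
have [|t tP at_] := @sign_conjs_ex _ _ (cst a) (Eq 0 0) (char_formulas k 0) => //.
have [|r _ [_ rt]] := ss' _ (map_f _ tP).
  exists (fun x => if x is 0 then a else s x) => [[|]//|]; split=> //.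
  apply: sat_fv_imp at_ => x.
  have Eq0 : fv (@Eq S 0 0) =i [:: 0] by move=> y; rewrite !inE orbb.
  have [|_ ->] := sign_conjs_GUF1 (GUF1_Eq sigma 0 0) Eq0 _ tP.
    move=> d /char_formulas_GUF1[gd dX]; split=> //.
      by apply: bool_comb_var gd dX _; rewrite inE.
    by move=> y; rewrite dX.
  by rewrite inE => /eqP ->.
exists (r 0); apply: (@char_formulas_sim _ 0) => th thF.
have [_ thX] := char_formulas_GUF1 thF.
have -> : sat (cst (r 0)) th <-> sat r th.
  by apply: sat_fv => y; rewrite thX inE => /eqP ->.
exact: sign_conjs_agree tP at_ rt _ thF.
Qed.

End Characteristic.

(** * Finite disjunctions and joint models *)

Section Interpolation.
Variable S : signature.
Implicit Types phi psi : formula S.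

Definition true_sentence : formula S := Exists [:: 0] (And (Eq 0 0) (Eq 0 0)).

Lemma sat_true (M : structure S) (s : nat -> M) : sat s true_sentence.
Proof. by exists s. Qed.

Definition disj (ws : seq (formula S)) : formula S :=
  foldr (fun w c => Neg (And (Neg w) (Neg c))) (Neg true_sentence) ws.

Lemma sat_disj (M : structure S) (s : nat -> M) ws :
  sat s (disj ws) <-> exists2 w, w \in ws & sat s w.
Proof.
elim: ws => [|w ws IH].
  by split=> [H|[]//]; case: H; apply: sat_true.
split=> [H|[v]].
  have [sw|nsw] := pselect (sat s w); first by exists w; rewrite ?mem_head.
  have [sc|nsc] := pselect (sat s (disj ws)); last by case: H.
  by have [v vws sv] := proj1 IH sc; exists v; rewrite // inE vws orbT.
rewrite inE => /orP[/eqP -> sw []//|vws sv [_]].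
by apply; apply/IH; exists v.
Qed.

Section Closure.
Variable sigma : vocabulary S.

Lemma GUF1_sentence_And phi psi : GUF1 sigma phi /\ sentence phi ->
  GUF1 sigma psi /\ sentence psi ->
  GUF1 sigma (And phi psi) /\ sentence (And phi psi).
Proof.
move=> [gphi phi0] [gpsi psi0]; split; last by rewrite /sentence /= phi0 psi0.
by apply: GUF1_And => //; apply: bool_comb_sentence.
Qed.

Lemma GUF1_sentence_Neg phi : GUF1 sigma phi /\ sentence phi ->
  GUF1 sigma (Neg phi) /\ sentence (Neg phi).
Proof. by move=> [g phi0]; split=> //; apply: GUF1_Neg. Qed.

Lemma GUF1_true : GUF1 sigma true_sentence /\ sentence true_sentence.
Proof.
split=> //; apply: GUF1_Exists => //; try exact: GUF1_Eq.
- by constructor.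
- by apply: GUF1_And; rewrite ?GUF1_Eq //; try exact: GUF1_Eq;
    apply: bool_comb_Eq.
- by move=> x; rewrite !inE orbb.
- by left.
Qed.

Lemma GUF1_disj ws : (forall w, w \in ws -> GUF1 sigma w /\ sentence w) ->
  GUF1 sigma (disj ws) /\ sentence (disj ws).
Proof.
elim: ws => [|w ws IH] wP; first exact/GUF1_sentence_Neg/GUF1_true.
apply/GUF1_sentence_Neg/GUF1_sentence_And; apply: GUF1_sentence_Neg.
  exact/wP/mem_head.
by apply: IH => v vws; apply: wP; rewrite inE vws orbT.
Qed.

End Closure.

(** Types are coded as bit vectors so that pairs of types form a finite type. *)
Definition type_vector phi (M : structure S) (x : M) : (size (subs phi)).-tuple bool :=
  map_tuple (fun theta => `[< sat (cst x) theta >]) (in_tuple (subs phi)).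

Lemma type_vector_eq phi (M N : structure S) (x : M) (y : N) :
  type_vector phi x = type_vector phi y ->
  forall theta, subformula theta phi -> sat (cst x) theta <-> sat (cst y) theta.
Proof.
move=> /(congr1 val) /= /eq_in_map xy theta /mem_subs /xy E.
by split=> /asboolP; [rewrite E|rewrite -E] => /asboolP.
Qed.

Definition shared phi psi := [seq R <- syms phi | R \in syms psi].

Lemma shared_vocI (sigma tau : vocabulary S) phi psi :
  GUF1 sigma phi -> GUF1 tau psi ->
  forall R : S, R \in shared phi psi -> vocI sigma tau R.
Proof.
move=> [gphi _ _] [gpsi _ _] R; rewrite mem_filter => /andP[Rpsi Rphi].
by split; [apply: GF_syms gphi Rphi | apply: GF_syms gpsi Rpsi].
Qed.

(** One more than the number of type pairs: the chain stabilises at some [k] up to that number, and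
    [k.+1] rounds must still be available. *)
Definition rounds phi psi :=
  #|{: (size (subs phi)).-tuple bool * (size (subs psi)).-tuple bool}|.+1.

(** The type sentences give every element a partner for [rounds phi psi] rounds, which is [total];
    stabilisation of P gives [stable]. The amalgam then satisfies [phi] and refutes [psi], its
    labels projecting to [M] and [N]. *)
Lemma joint_model (sigma tau : vocabulary S) phi psi :
  GUF1 sigma phi -> sentence phi -> GUF1 tau psi -> sentence psi ->
  forall (M N : structure S) (s : nat -> M) (s' : nat -> N),
  (forall theta, theta \in type_sentences (shared phi psi) (rounds phi psi) ->
     sat s theta <-> sat s' theta) ->
  sat s phi -> ~ sat s' psi ->
  exists (U : structure S) (t : nat -> U), sat t phi /\ ~ sat t psi.
Proof.
move=> gphi phi0 gpsi psi0 M N s s' ss' sphi spsi.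
set L := shared phi psi in ss'; set K := rounds phi psi in ss'.
pose Ms b := if b is true then M else N.
pose f b := if b is true then phi else psi.
have mem_L (R : S) : R \in L <-> (forall b, R \in syms (f b)).
  rewrite mem_filter; split=> [/andP[Rpsi Rphi] []//|H].
  by rewrite (H true) (H false).
have L_syms (R : S) : R \in L -> vocI sigma tau R.
  exact: shared_vocI.
pose tv (p : point Ms) := (type_vector phi (p true), type_vector psi (p false)).
pose P k := [set q | `[< exists2 p, psim L k p & q = tv p >]].
have [k kK Pk] : exists2 k, k <= K.-1 & P k = P k.+1.
  apply: chain_stabilises => k; apply/subsetP => q; rewrite !inE.
  by move=> /asboolP[p [sp _ _] ->]; apply/asboolP; exists p.
have stable (p : point Ms) : compatible f L k p ->
    exists2 q : point Ms, psim L k.+1 q & forall b, same_type f (p b) (q b).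
  case=> q sq pq; have : tv q \in P k by rewrite inE; apply/asboolP; exists q.
  rewrite Pk inE => /asboolP[r sr qr]; exists r => // b theta sub.
  rewrite (pq b theta sub); case: b sub.
    by move=> sub; apply: type_vector_eq (congr1 fst qr) _ sub.
  by move=> sub; apply: type_vector_eq (congr1 snd qr) _ sub.
have total b (x : Ms b) : exists2 p : point Ms, psim L k.+1 p & p b = x.
  have [y sxy] : exists y : Ms (~~ b), sim L K x y.
    case: b x => x.
      by apply: (type_sentences_total L_syms _ (s := s) (s' := s')) => th /ss' ->.
    by apply: (type_sentences_total L_syms _ (s := s') (s' := s)) => th /ss' ->.
  exists (mkpoint x y); last by rewrite mkpoint_id.
  apply/(psimE _ _ b); rewrite mkpoint_id mkpoint_neg.
  exact: sim_le sxy.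
exists (amalgam f total), (cst [::]).
have constP (Q : structure S) (u v : nat -> Q) th : sentence th ->
    sat u th <-> sat v th.
  by move=> th0; apply: sat_fv => x; rewrite th0.
have sz (th : formula S) : sentence th -> size (undup (fv th)) <= 1 by move=> ->.
split.
  apply/(amalgam_truth mem_L stable (b := true) gphi
    (subformula_refl _) (sz _ phi0)).
  exact/(constP M _ s phi phi0).
move/(amalgam_truth mem_L stable (b := false) gpsi
  (subformula_refl _) (sz _ psi0)) => H.
by apply: spsi; apply: (iffLR (constP N _ _ psi psi0) H).
Qed.

End Interpolation.

Theorem theorem1 (S : signature) (sigma tau : vocabulary S)
    (phi psi : formula S) :
  GUF1 sigma phi -> sentence phi ->
  GUF1 tau psi -> sentence psi ->
  entails phi psi ->
  exists chi : formula S,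
    [/\ GUF1 (vocI sigma tau) chi, sentence chi,
        entails phi chi & entails chi psi].
Proof.
move=> gphi phi0 gpsi psi0 ent.
pose Ts := type_sentences (shared phi psi) (rounds phi psi).
(* These are the theories, within [Ts], of the models of [phi]; only finitely many exist. *)
pose ws := [seq w <- sign_conjs (true_sentence S) Ts |
  `[< exists (M : structure S) (s : nat -> M), sat s phi /\ sat s w >]].
have [gt t0] := GUF1_true (vocI sigma tau).
have [|gchi chi0] := @GUF1_disj S (vocI sigma tau) ws.
  move=> w; rewrite mem_filter => /andP[_].
  have topX : fv (true_sentence S) =i [::] by [].
  have guf1_Ts := type_sentences_GUF1 (shared_vocI gphi gpsi).
  case/(sign_conjs_GUF1 gt topX) => [d /guf1_Ts[gd d0]|gw wX].
    by split=> //; [apply: bool_comb_sentence | rewrite d0].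
  split=> //; rewrite /sentence.
  by case: (fv w) wX => // x r /(_ x); rewrite mem_head.
exists (disj ws); split=> // M s.
  move=> sphi; have [w wTs sw] := sign_conjs_ex Ts (sat_true s).
  apply/sat_disj; exists w => //; rewrite mem_filter wTs andbT.
  by apply/asboolP; exists M, s.
(* A structure refuting [psi] would share the theory [w] with a model of [phi], and [joint_model]
   would contradict the entailment. *)
case/sat_disj=> w; rewrite mem_filter => /andP[/asboolP[M' [s' [sphi s'w]]] wTs] sw.
apply: contrapT => npsi.
have [U [t [tphi]]] := joint_model gphi phi0 gpsi psi0
  (sign_conjs_agree wTs s'w sw) sphi npsi.
by apply; apply: ent.
Qed.
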